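(* The following hold for $g(v,3)$: $g(v,3)=2$ for $v\in\{6,7\}$; $g(8,3)=3$; $g(9,3)\le 6$; $g(v,3)\le 6$ for $10\le v\le 12$; $g(v,3)\le 7$ for $v\in\{13,14\}$; $g(v,3)\le 16$ for $v\in\{15,16\}$; $g(v,3)\le 19$ for $17\le v\le 19$; and $g(v,3)\le 96$ for $20\le v\le 32$. These improve on the previously known upper bounds, which were $g(v,3)\le 8$ for $6\le v\le 9$ and $g(v,3)\le 160$ for $10\le v\le 32$.
   Context: For integers $v\ge t\ge 2$, let $[v]=\{0,\dots,v-1\}$, let $\mathcal{S}_v$ be the set of permutations of $[v]$ (bijections $[v]\to[v]$), and let $\mathcal{S}_{v,t}$ be the set of ordered sequences of $t$ distinct elements of $[v]$. A sequence $s=(s_0,\dots,s_{t-1})\in\mathcal{S}_{v,t}$ is covered by $\pi\in\mathcal{S}_v$ if $\pi^{-1}(s_i)<\pi^{-1}(s_{i+1})$ for $0\le i\le t-2$. For a positive integer $\lambda$, a PSCA$(v,t,\lambda)$ (perfect sequence covering array) is a multiset $X$ of permutations in $\mathcal{S}_v$ such that every sequence in $\mathcal{S}_{v,t}$ is covered by exactly $\lambda$ permutations in $X$ (counted with multiplicity). For $v\ge t\ge 2$, $g(v,t)$ denotes the smallest positive integer $\lambda$ such that a PSCA$(v,t,\lambda)$ exists. *)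

(* Defs.v *)
From mathcomp Require Import all_boot all_fingroup.
From mathcomp Require Import finmap multiset boolp.

Set Implicit Arguments.
Unset Strict Implicit.
Unset Printing Implicit Defensive.

Local Open Scope mset_scope.
Local Open Scope nat_scope.

(* [sorted] compares consecutive entries of [s]: pi^-1(s_i) < pi^-1(s_{i+1}). *)
Definition covers (v : nat) (s : seq 'I_v) (pi : {perm 'I_v}) : bool :=
  sorted (fun x y : 'I_v => (pi^-1)%g x < (pi^-1)%g y) s.

(* [count] is taken on the list underlying the multiset [X], in which each
   permutation is repeated according to its multiplicity. *)
Definition PSCA (v t lambda : nat) (X : {mset {perm 'I_v}}) : Prop :=
  forall s : t.-tuple 'I_v, uniq s -> count (covers s) X = lambda.

Lemma covers_mulr v (tau pi : {perm 'I_v}) (s : seq 'I_v) :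
  covers s (pi * tau)%g = covers (map (tau^-1)%g s) pi.
Proof.
rewrite /covers invMg sorted_map; case: s => //= a s.
by apply: eq_path => x y; rewrite /relpre /= !permM.
Qed.

Lemma perm_extend v (s s' : seq 'I_v) :
  uniq s -> uniq s' -> size s = size s' ->
  exists tau : {perm 'I_v}, map tau s = s'.
Proof.
case: s => [|x0 s0]; first by case: s' => // _ _ _; exists 1%g.
move: (x0 :: s0) => s us us' ss.
pose L (r : seq 'I_v) := r ++ [seq x <- enum 'I_v | x \notin r].
have uL r : uniq r -> uniq (L r).
  move=> ur; rewrite cat_uniq ur filter_uniq ?enum_uniq // andbT.
  by apply/hasPn => x; rewrite mem_filter => /andP[].
have memL r x : x \in L r.
  by rewrite mem_cat mem_filter mem_enum andbT; case: (x \in r).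
have sL r : uniq r -> size (L r) = v.
  move=> ur; rewrite -[RHS]card_ord -(card_uniqP (uL _ ur)).
  by apply: eq_card => x; rewrite memL.
pose f x := nth x0 (L s') (index x (L s)).
have finj : injective f.
  move=> x y /eqP; rewrite nth_uniq ?uL // ?sL // -?[X in _ < X](sL s us) ?index_mem //.
  by move/eqP => /(congr1 (nth x0 (L s))); rewrite !nth_index.
exists (perm finj); apply: (@eq_from_nth _ x0); rewrite ?size_map // => i lti.
rewrite (nth_map x0) // permE /f /L index_cat mem_nth // index_uniq //.
by rewrite nth_cat -ss lti.
Qed.

(* The multiset of all permutations is perfect, so the minimum below exists. *)
Lemma PSCA_exists (v t : nat) :
  exists lambda, (0 < lambda) && `[< exists X, PSCA t lambda (X : {mset {perm 'I_v}}) >].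
Proof.
have [[s us]|noS] := pselect (exists s : t.-tuple 'I_v, uniq s); last first.
  exists 1; rewrite /=; apply/asboolP; exists mset0 => s us.
  by case: noS; exists s.
pose le (x y : 'I_v) := x <= y.
pose s0 := [tuple of sort le s].
have us0 : uniq s0 by rewrite sort_uniq.
have cov1 : covers s0 1%g.
  have /= tot : total le by move=> x y; exact: leq_total.
  have : sorted ltn (map val s0).
    rewrite ltn_sorted_uniq_leq (map_inj_uniq val_inj) us0 /= sorted_map.
    exact: sort_sorted.
  rewrite sorted_map; apply: sub_sorted => x y /=.
  by rewrite invg1 !perm1.
pose X := seq_mset (enum {perm 'I_v}).
have cX (r : seq 'I_v) : count (covers r) X = #|[pred pi | covers r pi]|.
  by rewrite (seq.permP (perm_eq_seq_mset _)) -size_filter enumT cardE.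
exists (count (covers s0) X); apply/andP; split.
  by rewrite cX; apply/card_gt0P; exists 1%g.
apply/asboolP; exists X => r ur; rewrite !cX.
have eq_sz : size s0 = size r by rewrite !size_tuple.
have [tau tE] := perm_extend us0 ur eq_sz.
rewrite -!sum1_card [RHS](reindex_inj (mulIg tau^-1%g)).
by apply: eq_bigl => pi; rewrite !inE covers_mulr invgK tE.
Qed.

Definition g (v t : nat) : nat := ex_minn (PSCA_exists v t).

(* Main.v *)
Require Import Defs.
From mathcomp Require Import all_boot all_fingroup.
From mathcomp Require Import finmap multiset boolp zify.

(** Fix a symbol [a] of a perfect array for triples of multiplicity [lambda], and
    for every other symbol [b] let [w_b] be the set of rows in which [a] precedes
    [b].  Each [w_b] has [3 * lambda] elements and any two of them meet in
    [2 * lambda] elements.  Conversely these two families of numbers, taken over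
    all [a], determine the array to be perfect: the rows in which [c], [a], [b]
    occur in this order are those of [w_b] outside [w_c], so there are
    [3 * lambda - 2 * lambda] of them.  Both halves of the theorem are read off
    this system of sets.

    Lower bounds.  For [lambda = 1] there are no five sets of size 3 in a 6-element
    set which meet pairwise in 2 elements, so six symbols are too many
    ([no_PSCA1]).  For [lambda = 2] and eight symbols, seven 6-subsets of a
    12-element set which meet pairwise in 4 elements have at least two elements
    in common.  Hence each of the eight symbols comes first in at least two of
    the twelve rows, which is absurd ([no_PSCA2]).  Both facts on set systems come
    from a short exhaustive search in which points lying in the same sets are not
    distinguished ([searchP]).

    Upper bounds.  Deleting symbols from a perfect array leaves a perfect array
    with the same multiplicity, so arrays on 7, 8, 12, 14, 16, 19 and 32 symbols
    suffice ([g_le]).  Each is a union of few orbits of a permutation group on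
    the symbols, and the two families of numbers are checked by computation.
    On 32 symbols the group contains a regular elementary abelian subgroup, so
    that only one choice of [a] has to be checked ([balanced_translates]). *)

Set Implicit Arguments.
Unset Strict Implicit.
Unset Printing Implicit Defensive.

Local Open Scope mset_scope.
Local Open Scope nat_scope.

(** * How often a symbol precedes others in a perfect array *)

Lemma count_split (T : eqType) (a b c : pred T) (s : seq T) :
  {in s, forall x, (a x : nat) = b x + c x} -> count a s = count b s + count c s.
Proof.
elim: s => //= x s IH abc; rewrite abc ?mem_head // IH 1?addnACA // => y ys.
by rewrite abc // inE ys orbT.
Qed.

Lemma g_PSCA (v t : nat) :
  0 < g v t /\ exists X, PSCA t (g v t) (X : {mset {perm 'I_v}}).
Proof. by rewrite /g; case: ex_minnP => l /andP[? /asboolP]. Qed.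

Lemma g_min (v t lambda : nat) (X : {mset {perm 'I_v}}) :
  0 < lambda -> PSCA t lambda X -> g v t <= lambda.
Proof.
move=> l0 XP; rewrite /g; case: ex_minnP => l _; apply.
by rewrite l0; apply/asboolP; exists X.
Qed.

Section Precedence.
Variables (v lambda : nat) (X : {mset {perm 'I_v}}).
Hypotheses (v3 : 2 < v) (XP : PSCA 3 lambda X).

Definition precedes (pi : {perm 'I_v}) (a b : 'I_v) : bool :=
  (pi^-1)%g a < (pi^-1)%g b.

Lemma precedesN (pi : {perm 'I_v}) a b :
  a != b -> precedes pi b a = ~~ precedes pi a b.
Proof.
rewrite /precedes; case: ltngtP => // /val_inj/perm_inj ->.
by rewrite eqxx.
Qed.

Lemma count_chain a b c : uniq [:: a; b; c] ->
  count (fun pi => precedes pi a b && precedes pi b c) X = lambda.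
Proof.
move=> u; rewrite -(XP (s := [tuple a; b; c]) u); apply: eq_count => pi.
by rewrite /covers /= andbT.
Qed.

(** Whichever of [b] and [c] comes second, [a] starts one of the chains
    [a b c] and [a c b]. *)
Lemma count_first a b c : uniq [:: a; b; c] ->
  count (fun pi => precedes pi a b && precedes pi a c) X = lambda * 2.
Proof.
move=> u; have := u; rewrite /= !inE negb_or andbT -andbA => /and3P[ab ac bc].
rewrite (@count_split _ _ (fun pi => precedes pi a b && precedes pi b c)
          (fun pi => precedes pi a c && precedes pi c b)).
  rewrite !count_chain ?muln2 ?addnn //= !inE negb_or andbT ac ab eq_sym bc //.
by move=> pi _; rewrite (precedesN pi bc) /precedes; lia.
Qed.

(** A third symbol lies either after [a] or before it, which splits the rows with
    [a] before [b] into [2 * lambda] rows and one chain. *)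
Lemma count_precedes a b : a != b -> count (fun pi => precedes pi a b) X = lambda * 3.
Proof.
move=> ab; have [c cab] : exists c, c \notin [:: a; b].
  suff: 0 < #|~: [set a; b]| by case/card_gt0P => c; rewrite !inE; exists c; rewrite !inE.
  by rewrite -(ltn_add2l #|[set a; b]|) addn0 cardsC card_ord cards2 ab.
move: cab; rewrite !inE negb_or => /andP[ca cb].
rewrite (@count_split _ _ (fun pi => precedes pi a b && precedes pi a c)
          (fun pi => precedes pi c a && precedes pi a b)).
  rewrite count_first ?count_chain -?mulnSr //= !inE negb_or ?andbT ?ca ?cb ?ab //.
  by rewrite eq_sym ca eq_sym cb.
by move=> pi _; rewrite (precedesN pi ca); lia.
Qed.

Lemma count_first_pair a b c : a != b -> a != c ->
  count (fun pi => precedes pi a b && precedes pi a c) X = lambda * (if b == c then 3 else 2).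
Proof.
move=> ab ac; case: eqVneq => [<-|bc].
  by rewrite -(count_precedes ab); apply: eq_count => pi; rewrite andbb.
by apply: count_first; rewrite /= !inE negb_or ab ac bc.
Qed.

Lemma size_PSCA : size X = lambda * 6.
Proof.
pose a : 'I_v := Ordinal (ltnW (ltnW v3)); pose b : 'I_v := Ordinal (ltnW v3).
have ab : a != b by [].
rewrite -(count_predT X) (@count_split _ _ (fun pi => precedes pi a b)
          (fun pi => precedes pi b a)).
  by rewrite !count_precedes // -mulnDr.
by move=> pi _; rewrite (precedesN pi ab); case: precedes.
Qed.
End Precedence.

(** * Systems of sets with prescribed pairwise intersections *)

(** Points that lie in the same sets so far are interchangeable, so a partial
    system is recorded as a list of groups [(n, p)]: there are [n] points with
    membership pattern [p].  A pattern lists the sets chosen so far, latest first,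
    and ends with a [true] for the set of all points; with this convention the
    size of a new set is one more prescribed intersection. *)
Definition expand (st : seq (nat * bitseq)) : seq bitseq :=
  flatten [seq nseq g.1 g.2 | g <- st].

Definition add_group n p (st : seq (nat * bitseq)) :=
  if n is 0 then st else (n, p) :: st.

(** All ways to add one set whose intersection with the [j]-th earlier set has
    [nth 0 need j] points: [c] of the [n] points of each group go into the new
    set. *)
Fixpoint split_groups (need : seq nat) (st : seq (nat * bitseq)) :
    seq (seq (nat * bitseq)) :=
  if st is (n, p) :: st' then
    let share c j := nth false p j * c in
    flatten
      [seq [seq add_group c (true :: p) (add_group (n - c) (false :: p) s)
           | s <- split_groups (mkseq (fun j => nth 0 need j - share c j) (size need)) st']
      | c <- iota 0 n.+1 & all (fun j => share c j <= nth 0 need j) (iota 0 (size need))]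
  else if all (pred1 0) need then [:: [::]] else [::].

(** [test] holds for every way to add [k] sets meeting the earlier ones as told by
    [need] and each other in [lambda * 2] points. *)
Fixpoint search (test : pred (seq (nat * bitseq))) lambda k need st : bool :=
  if k is k'.+1 then
    all (search test lambda k' (lambda * 2 :: need)) (split_groups need st)
  else test st.

Lemma expand_add_group n p st : expand (add_group n p st) = nseq n p ++ expand st.
Proof. by case: n. Qed.

Lemma perm_bools (bs : bitseq) :
  perm_eq bs (nseq (count id bs) true ++ nseq (size bs - count id bs) false).
Proof.
apply/seq.permP => a; rewrite count_cat !count_nseq.
have := count_size id bs; elim: bs => [|b bs IH] /=; first by rewrite !muln0.
by have := count_size id bs => /[dup] /IH -> ; case: b; nia.
Qed.

Lemma map_perm_inv (C : eqType) (T : eqType) (f : C -> T) X t :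
  perm_eq (map f X) t -> exists2 X', perm_eq X X' & map f X' = t.
Proof.
case: X => [|x0 X0]; first by rewrite perm_sym => /perm_nilP ->; exists [::].
move: (x0 :: X0) => X; rewrite perm_sym.
case/(perm_iotaP (f x0)) => Is; rewrite size_map => pI ->.
exists (map (nth x0 X) Is); first by rewrite perm_sym; apply/(perm_iotaP x0); exists Is.
rewrite -map_comp; apply/eq_in_map => i; rewrite (perm_mem pI) mem_iota => /= lti.
by rewrite (nth_map x0).
Qed.

(** The points of a group are consecutive in [X]; the number [c] of those in [w]
    is the choice that leads to the required element of [split_groups]. *)
Lemma split_groupsP (C : eqType) (X : seq C) (pat : C -> bitseq) (w : pred C) need st :
  map pat X = expand st ->
  (forall j, j < size need ->
     count (fun x => w x && nth false (pat x) j) X = nth 0 need j) ->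
  exists2 s, s \in split_groups need st & perm_eq [seq w x :: pat x | x <- X] (expand s).
Proof.
elim: st X need => [|[n p] st IH] X need /=.
  case: X => // _ need0; exists [::] => //.
  suff -> : all (pred1 0) need by rewrite inE.
  by apply/(all_nthP 0) => j /need0 /= <-.
rewrite -[expand (_ :: _)]/(nseq n p ++ expand st) => patX needX.
set X1 := take n X; set X2 := drop n X; have XE : X = X1 ++ X2 by rewrite cat_take_drop.
have sX1 : size X1 = n.
  by rewrite size_takel // -(size_map pat) patX size_cat size_nseq leq_addr.
have /eqP : map pat X1 ++ map pat X2 = nseq n p ++ expand st by rewrite -map_cat -XE.
rewrite eqseq_cat ?size_map ?size_nseq // => /andP[/eqP pX1 /eqP pX2].
have pat1 : {in X1, forall x, pat x = p}.
  by move=> x /(map_f pat); rewrite pX1 => /nseqP[].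
set c := count w X1; have cn : c <= n by rewrite -sX1 count_size.
have split_need j : j < size need ->
    nth false p j * c + count (fun x => w x && nth false (pat x) j) X2 = nth 0 need j.
  move=> /needX <-; rewrite XE count_cat; congr (_ + _).
  rewrite (@eq_in_count _ _ (fun x => w x && nth false p j) X1); last first.
    by move=> x /pat1 ->.
  case: (nth false p j); first by rewrite mul1n; apply: eq_count => x; rewrite andbT.
  by rewrite mul0n -(count_pred0 X1); apply: eq_count => x; rewrite andbF.
have [||s sIn sP] := IH X2 (mkseq (fun j => nth 0 need j - nth false p j * c) (size need)).
- exact: pX2.
- move=> j; rewrite size_mkseq => ltj; rewrite nth_mkseq //.
  by rewrite -(split_need _ ltj) addKn.
exists (add_group c (true :: p) (add_group (n - c) (false :: p) s)).
  apply/flattenP; exists [seq add_group c (true :: p) (add_group (n - c) (false :: p) s)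
           | s <- split_groups (mkseq (fun j => nth 0 need j - nth false p j * c) (size need)) st];
    last exact: map_f.
  apply/mapP; exists c => //.
  (* Simplification has unfolded the enumeration of the values of [c]. *)
  rewrite -[X in _ \in X]/[seq c <- iota 0 n.+1
    | all (fun j => nth false p j * c <= nth 0 need j) (iota 0 (size need))].
  rewrite mem_filter mem_iota /= ltnS cn andbT.
  apply/allP => j; rewrite mem_iota /= => /split_need <-; exact: leq_addr.
rewrite !expand_add_group catA {1}XE map_cat perm_cat //.
have -> : [seq w x :: pat x | x <- X1] = [seq b :: p | b <- map w X1].
  by rewrite -map_comp; apply/eq_in_map => x /pat1 /= ->.
have := perm_map (cons^~ p) (perm_bools (map w X1)).
by rewrite map_cat !map_nseq count_map size_map sX1.
Qed.

(** The points are the elements of [X], the new sets are the [W i]; [catrev] adds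
    the membership of a point in them to its pattern, latest first. *)
Lemma searchP (C I : eqType) (W : I -> pred C) test lambda s need st (X : seq C)
    (pat : C -> bitseq) :
  search test lambda (size s) need st -> uniq s -> perm_eq (map pat X) (expand st) ->
  (forall i j, i \in s -> j < size need ->
     count (fun x => W i x && nth false (pat x) j) X = nth 0 need j) ->
  {in s &, forall i j, i != j -> count (fun x => W i x && W j x) X = lambda * 2} ->
  exists2 st', test st' &
    perm_eq [seq catrev [seq W i x | i <- s] (pat x) | x <- X] (expand st').
Proof.
elim: s need st pat => [|i s IH] need st pat /=.
  by move=> ? _ pX _ _; exists st.
move=> /allP srch /andP[i_s us] /map_perm_inv[X' pX XE] needX WX.
have cX a : count a X = count a X' by move/seq.permP: pX.
have [s' /srch srch' ps'] : exists2 s', s' \in split_groups need st &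
    perm_eq [seq W i x :: pat x | x <- X'] (expand s').
  by apply: split_groupsP => // j ltj; rewrite -cX needX ?mem_head.
apply: (IH _ _ (fun x => W i x :: pat x) srch') => //.
- by rewrite -(permPr ps') perm_map.
- move=> k [|j] ks /=.
    by move=> _; apply: WX; rewrite ?inE ?eqxx ?ks ?orbT //; apply: contraNneq i_s => <-.
  by rewrite ltnS => ltj; apply: needX; rewrite // inE ks orbT.
- by move=> k l ks ls; apply: WX; rewrite inE ?ks ?ls orbT.
Qed.

(** * Perfect arrays that do not exist *)

Definition first_of v (s : seq 'I_v) (a : 'I_v) (pi : {perm 'I_v}) :=
  all (precedes pi a) s.

(** The rows in which [a] is before all of [s] are the points common to all the
    sets of the system. *)
Lemma search_PSCA v lambda (X : {mset {perm 'I_v}}) (a : 'I_v) (s : seq 'I_v) test :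
  2 < v -> PSCA 3 lambda X -> uniq s -> a \notin s ->
  search test lambda (size s) [:: lambda * 3] [:: (lambda * 6, [:: true])] ->
  exists2 st, test st & count (first_of s a) X = count (all id) (expand st).
Proof.
move=> v3 XP us a_s srch.
have aN b : b \in s -> a != b by apply: contraTneq => <-.
have [||||st tst pst] := @searchP _ _ (fun b pi => precedes pi a b) test lambda s _ _ X
   (fun=> [:: true]) srch => //.
- rewrite /expand /= cats0 -(size_PSCA v3 XP) -[size X](size_map (fun=> [:: true])).
  by rewrite -(all_pred1P _ _ _) // all_map; apply/allP => pi _ /=.
- move=> b [|//] /aN ab _ /=; rewrite -(count_precedes v3 XP ab).
  by apply: eq_count => pi; rewrite andbT.
- move=> b c /aN ab /aN ac bc; by rewrite (count_first_pair v3 XP) // (negbTE bc).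
exists st => //; have /seq.permP <- := pst; rewrite count_map; apply: eq_count => pi /=.
rewrite catrevE all_cat all_rev andbT /first_of all_map; exact: eq_all.
Qed.

(** The triples of a 4-set are four 3-subsets meeting pairwise in 2 points; a fifth
    one does not exist, so the search has no leaf at which the test could fail. *)
Lemma no_five_triples : search pred0 1 5 [:: 3] [:: (6, [:: true])].
Proof. by vm_compute. Qed.

(** The search starts from a single group of 12 points; a pattern without [false]
    belongs to a point that lies in all seven sets. *)
Lemma seven_sextuples_meet :
  search (fun st => 1 < count (all id) (expand st)) 2 7 [:: 6] [:: (12, [:: true])].
Proof. by vm_compute. Qed.

Lemma no_PSCA1 v (X : {mset {perm 'I_v}}) : 5 < v -> ~ PSCA 3 1 X.
Proof.
move=> v5 XP; pose a : 'I_v := Ordinal (leq_trans (isT : 0 < 6) v5).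
pose s := take 5 (rem a (enum 'I_v)).
have s5 : size s = 5 by rewrite size_takel // size_rem ?mem_enum // size_enum_ord; lia.
have a_s : a \notin s.
  by apply/negP => /mem_take; rewrite mem_rem_uniq ?enum_uniq // inE eqxx.
have us : uniq s by rewrite take_uniq // rem_uniq // enum_uniq.
by have [||st] := @search_PSCA v 1 X a s pred0 _ XP us a_s; rewrite ?s5 ?no_five_triples //; lia.
Qed.

(** Every symbol is first in at least two rows, but twelve rows have only twelve
    first places for the eight symbols. *)
Lemma no_PSCA2 (X : {mset {perm 'I_8}}) : ~ PSCA 3 2 X.
Proof.
move=> XP; pose others a := rem a (enum 'I_8).
have othersE a b : (b \in others a) = (b != a).
  by rewrite mem_rem_uniq ?enum_uniq // !inE mem_enum andbT.
have first2 a : 2 <= count (first_of (others a) a) X.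
  have so : size (others a) = 7 by rewrite size_rem ?mem_enum // size_enum_ord.
  have [||||st st2 ->] := @search_PSCA 8 2 X a (others a)
    (fun st => 1 < count (all id) (expand st)) _ XP => //.
  - by rewrite rem_uniq // enum_uniq.
  - by rewrite othersE eqxx.
  - by rewrite so seven_sextuples_meet.
have : \sum_(a < 8) 2 <= \sum_(a < 8) count (first_of (others a) a) X.
  by apply: leq_sum => a _.
rewrite leqNgt => /negP[]; rewrite sum_nat_const card_ord.
under eq_bigr do rewrite -sum1_count big_mkcond.
rewrite exchange_big /=; apply: (@leq_ltn_trans (\sum_(pi <- X) 1)); last first.
  by rewrite sum1_size (size_PSCA _ XP).
apply: leq_sum => pi _; rewrite -big_mkcond sum1_card.
apply/card_le1_eqP => a b; rewrite !unfold_in => /allP fa /allP fb.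
case: (eqVneq a b) => [//|ab]; have ba : b != a by rewrite eq_sym.
have := fa b; have := fb a; rewrite !othersE ab ba => /(_ isT) + /(_ isT).
by rewrite (precedesN pi ab) => /negbTE ->.
Qed.

(** * Perfect arrays from tables of positions *)

(** Any injective assignment of numbers to the symbols orders them, and so gives a
    permutation; this makes deleting symbols a mere restriction. *)
Section PermOfRank.
Variables (v : nat) (rho : 'I_v -> nat).
Hypothesis rho_inj : injective rho.

Definition rank_set (x : 'I_v) := [set y | rho y < rho x].

Lemma rank_set_lt x : #|rank_set x| < v.
Proof.
rewrite -[X in _ < X]card_ord -cardsT; apply: proper_card.
by apply/properP; split; [apply: subsetT | exists x; rewrite !inE ?ltnn].
Qed.

Definition rank (x : 'I_v) : 'I_v := Ordinal (rank_set_lt x).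

Lemma ltn_rank x y : (rank x < rank y) = (rho x < rho y).
Proof.
have lt_rank a b : rho a < rho b -> rank a < rank b.
  move=> ab; apply: proper_card; apply/properP; split; last first.
    by exists a; rewrite !inE ?ltnn.
  by apply/subsetP => z; rewrite !inE => /ltn_trans; apply.
apply/idP/idP; last exact: lt_rank.
apply: contraTT; rewrite -!leqNgt leq_eqVlt => /orP[/eqP/rho_inj -> //|/lt_rank].
exact: ltnW.
Qed.

Lemma rank_inj : injective rank.
Proof.
move=> x y xy; have := ltn_rank x y; have := ltn_rank y x; rewrite xy ltnn.
by case: ltngtP => // /rho_inj.
Qed.

Definition perm_of_rank : {perm 'I_v} := (perm rank_inj)^-1%g.

Lemma covers_perm_of_rank (s : seq 'I_v) :
  covers s perm_of_rank = sorted (fun x y => rho x < rho y) s.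
Proof.
rewrite /covers invgK; case: s => //= x s.
by apply: eq_path => a b; rewrite !permE ltn_rank.
Qed.
End PermOfRank.

(** A row [r] lists the positions of the symbols: [nth 0 r i] is that of [i]. *)
Definition before (r : seq nat) i j := nth 0 r i < nth 0 r j.

Definition is_position_table v (A : seq (seq nat)) :=
  all (fun r => (size r == v) && uniq r) A.

(** For [j = k] this counts the rows with [i] before [j]. *)
Definition balanced_at lambda v A i := forall j k, j < v -> k < v -> j != i -> k != i ->
  count (fun r => before r i j && before r i k) A = lambda * (if j == k then 3 else 2).

(** Rows with [c], [a], [b] in this order are the rows with [a] before [b] that do
    not have [a] before [c]: [3 * lambda - 2 * lambda] of them. *)
Lemma g_le lambda v A w :
  0 < lambda -> is_position_table v A -> (forall i, i < v -> balanced_at lambda v A i) ->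
  w <= v -> g w 3 <= lambda.
Proof.
move=> l0 /allP tabA balA wv.
pose rho (r : seq nat) (x : 'I_w) := nth 0 r x.
have ltv (x : 'I_w) : x < v by apply: leq_trans wv.
have rho_inj r : r \in A -> injective (rho r).
  move=> /tabA /andP[/eqP sr ur] x y /eqP.
  by rewrite nth_uniq ?sr ?ltv // => /eqP/val_inj.
pose row r : {perm 'I_w} :=
  if pselect (injective (rho r)) is left inj then perm_of_rank inj else 1%g.
apply: (@g_min _ _ _ (seq_mset (map row A))) => // s us.
rewrite (seq.permP (perm_eq_seq_mset _)) count_map.
case: s us => [] [|c [|a [|b []]]] // ss; rewrite /= !inE negb_or andbT -andbA.
move=> /and3P[ca cb ab].
have -> : count (preim row (covers [:: c; a; b])) A =
          count (fun r => before r c a && before r a b) A.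
  apply: eq_in_count => r rA; rewrite -[LHS]/(covers [:: c; a; b] (row r)) /row.
  case: pselect => [inj|]; last by case; apply: rho_inj.
  by rewrite covers_perm_of_rank /= andbT.
have nat_neq (x y : 'I_w) : x != y -> (x != y :> nat) by [].
have ba : b != a :> nat by rewrite eq_sym nat_neq.
have bc : b != c :> nat by rewrite eq_sym nat_neq.
have := balA a (ltv a) b c (ltv b) (ltv c) ba (nat_neq _ _ ca).
have := balA a (ltv a) b b (ltv b) (ltv b) ba ba.
rewrite eqxx (negbTE bc) => bb abc.
apply/eqP; rewrite -(eqn_add2r (lambda * 2)) -mulnS -bb -abc; apply/eqP/esym.
apply: count_split => r /rho_inj inj; have := contra_neq (@inj c a) ca.
by rewrite /before /rho; lia.
Qed.

Definition check_at lambda v A i : bool :=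
  let l2 := lambda * 2 in let l3 := lambda * 3 in
  let ws := [seq (j, [seq before r i j | r <- A]) | j <- iota 0 v & j != i] in
  all2rel (fun w w' : nat * bitseq =>
    count (fun b => b.1 && b.2) (zip w.2 w'.2) == if w.1 == w'.1 then l3 else l2) ws.

Lemma check_atP lambda v A i : check_at lambda v A i -> balanced_at lambda v A i.
Proof.
move/allrelP => chk j k jv kv ji ki.
have inW l : l < v -> l != i -> (l, [seq before r i l | r <- A]) \in
    [seq (j, [seq before r i j | r <- A]) | j <- iota 0 v & j != i].
  move=> lv li; apply: (map_f (fun l => (l, [seq before r i l | r <- A]))).
  by rewrite mem_filter li mem_iota.
have /eqP := chk _ _ (inW j jv ji) (inW k kv ki).
by rewrite /= zip_map count_map => ->; case: ifP.
Qed.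

Definition check lambda v A : bool :=
  is_position_table v A && all (check_at lambda v A) (iota 0 v).

Lemma g_le_check lambda v A w :
  check lambda.+1 v A -> w <= v -> g w 3 <= lambda.+1.
Proof.
case/andP=> tabA /allP chk; apply: g_le tabA _ => // i iv.
by apply/check_atP/chk; rewrite mem_iota.
Qed.

(** * Arrays invariant under translations *)

(** The array consists of all translates of some rows under an elementary abelian
    2-group.  Translating by the [i]-th symbol permutes the rows and exchanges this
    symbol with the first one, zero, so the counts at [i] are counts at [0]. *)
Section Translates.
Variables (T : eqType) (add : T -> T -> T) (z : T) (D : seq T).
Hypotheses (addA : associative add) (addC : commutative add).
Hypotheses (addz : left_id z add) (addxx : forall x, add x x = z).
Hypotheses (uniqD : uniq D) (memD : forall x, x \in D) (D0 : nth z D 0 = z).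
Variables (p : T -> nat) (H : seq (T -> T)).

Definition translates : seq (seq nat) :=
  [seq [seq p (h (add x t)) | x <- D] | h <- H, t <- D].

Lemma balanced_translates lambda :
  balanced_at lambda (size D) translates 0 ->
  forall i, i < size D -> balanced_at lambda (size D) translates i.
Proof.
move=> bal0 i ltiD j k ltjD ltkD ji ki.
pose x n := nth z D n; pose shift n := index (add (x i) (x n)) D.
have addK y : involutive (add y) by move=> u; rewrite addA addxx addz.
have x_shift n : x (shift n) = add (x i) (x n) by rewrite /x nth_index.
have shift_lt n : shift n < size D by rewrite index_mem.
have shift_inj m n : m < size D -> n < size D -> (shift m == shift n) = (m == n).
  move=> ltm ltn; apply/eqP/eqP => [mn|-> //]; apply/eqP.
  rewrite -(nth_uniq z ltm ltn uniqD); apply/eqP/(can_inj (addK (x i))).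
  by rewrite -!x_shift mn.
have shift_i : shift i = 0.
  by rewrite /shift addxx -{1}D0 index_uniq //; apply: leq_trans ltiD.
have <- := shift_inj _ _ ltjD ltkD.
rewrite -(bal0 _ _ (shift_lt j) (shift_lt k)) -?shift_i ?shift_inj //.
rewrite /translates !count_flatten; congr sumn.
rewrite -!map_comp; apply: eq_map => h; rewrite /comp !count_map.
have /seq.permP pD : perm_eq [seq add (x i) t | t <- D] D.
  apply: uniq_perm => //; first by rewrite map_inj_uniq //; apply: can_inj (addK _).
  by move=> y; rewrite memD; apply/mapP; exists (add (x i) y); rewrite ?memD ?addK.
rewrite -[LHS]pD count_map; apply: eq_count => t /=.
have row u n : n < size D -> nth 0 [seq p (h (add y u)) | y <- D] n = p (h (add (x n) u)).
  by move=> ltn; rewrite (nth_map z).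
have regroup a : add a (add (x i) t) = add (add (x i) a) t by rewrite addA (addC a).
by rewrite /before !row // !x_shift !regroup.
Qed.
End Translates.

(** * The arrays *)

(** The row given by [f] and [q] puts the symbol [x] where the base row [q] puts
    [f x].  When the [f] run over a permutation group these rows are the orbits of
    the base rows. *)
Definition orbit_rows (T : Type) (D : seq T) (maps : seq (T -> nat))
    (bases : seq (seq nat)) : seq (seq nat) :=
  [seq [seq nth 0 q (f x) | x <- D] | f <- maps, q <- bases].

(** The rotations of six symbols, with a seventh one fixed. *)
Definition array7 : seq (seq nat) :=
  orbit_rows (iota 0 7) [seq (fun x => if x == 6 then 6 else (x + t) %% 6) | t <- iota 0 6]
    [:: [:: 3; 0; 2; 1; 4; 6; 5]; [:: 5; 0; 3; 6; 4; 2; 1]].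

(** A fixed-point-free involution. *)
Definition array8 : seq (seq nat) :=
  orbit_rows (iota 0 8) [:: id; fun x => if odd x then x.-1 else x.+1]
    [:: [:: 5; 4; 0; 2; 3; 7; 6; 1]; [:: 0; 4; 1; 5; 3; 2; 6; 7];
        [:: 3; 0; 5; 6; 7; 4; 2; 1]; [:: 1; 7; 6; 4; 0; 2; 5; 3];
        [:: 7; 4; 6; 5; 3; 0; 1; 2]; [:: 5; 7; 0; 3; 2; 6; 1; 4];
        [:: 5; 3; 1; 6; 0; 4; 2; 7]; [:: 4; 0; 2; 6; 7; 3; 5; 1];
        [:: 3; 1; 5; 0; 6; 4; 2; 7]].

(** The Frobenius group of order 42 acting on [Z/7 * Z/2]: multiplication by the
    non-residue 3 also exchanges the two copies of [Z/7]. *)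
Definition array14 : seq (seq nat) :=
  orbit_rows (iota 0 14)
    [seq (fun x => (3 ^ i * (x %% 7) + t) %% 7 + (x %/ 7 + i) %% 2 * 7)
    | i <- iota 0 6, t <- iota 0 7]
    [:: [:: 0; 4; 7; 3; 1; 13; 9; 10; 6; 8; 2; 12; 5; 11]].

(** The maps [a * x + t] of [Z/19], with [a] in the subgroup of order 6. *)
Definition array19 : seq (seq nat) :=
  orbit_rows (iota 0 19)
    [seq (fun x => (a * x + t) %% 19) | a <- [:: 1; 8; 7; 18; 11; 12], t <- iota 0 19]
    [:: [:: 2; 1; 14; 4; 0; 17; 18; 6; 7; 15; 12; 5; 10; 11; 8; 9; 13; 3; 16]].

(** The field with four elements; [(a, b)] stands for [a + b * w] with
    [w ^ 2 = w + 1]. *)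
Definition F4 := (bool * bool)%type.
Definition addF4 (x y : F4) : F4 := (x.1 (+) y.1, x.2 (+) y.2).
Definition mulw (x : F4) : F4 := (x.2, x.1 (+) x.2).
Definition codeF4 (x : F4) : nat := x.1 + x.2 * 2.
Definition F4_elts : seq F4 := [seq (a, b) | b <- [:: false; true], a <- [:: false; true]].

(** The maps [w ^ i * x + t] on the first factor of [F4 * Z/3] combined with the
    translations of the second one: the group [A_4 * C_3]. *)
Definition array12 : seq (seq nat) :=
  let D := [seq (x, k) | k <- iota 0 3, x <- F4_elts] in
  orbit_rows D
    [seq (fun x : F4 * nat =>
            codeF4 (addF4 (iter i mulw x.1) t.1) + (x.2 + t.2) %% 3 * 4)
    | i <- iota 0 3, t <- D]
    [:: [:: 7; 10; 4; 11; 5; 2; 9; 1; 6; 3; 8; 0]].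

(** The translations of [F4 * F4], the multiplications by powers of [w] and the
    exchange of the two factors. *)
Definition array16 : seq (seq nat) :=
  let D := [seq (x, y) | y <- F4_elts, x <- F4_elts] in
  orbit_rows D
    [seq (fun x : F4 * F4 =>
            let y := iter si.2 mulw (addF4 x.1 t.1) in
            let z := iter si.2 mulw (addF4 x.2 t.2) in
            if si.1 then codeF4 z + codeF4 y * 4 else codeF4 y + codeF4 z * 4)
    | si <- [seq (s, i) | s <- [:: false; true], i <- iota 0 3], t <- D]
    [:: [:: 2; 11; 0; 1; 8; 7; 9; 10; 4; 14; 5; 6; 13; 3; 12; 15]].

Definition V := (F4 * F4 * bool)%type.
Definition addV (x y : V) : V := (addF4 x.1.1 y.1.1, addF4 x.1.2 y.1.2, x.2 (+) y.2).
Definition V0 : V := (false, false, (false, false), false).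
Definition codeV (x : V) : nat := codeF4 x.1.1 + codeF4 x.1.2 * 4 + x.2 * 16.
Definition V_elts : seq V :=
  [seq (x, c) | c <- [:: false; true], x <- [seq (y, z) | z <- F4_elts, y <- F4_elts]].

(** Independent multiplications of the two factors [F4] by powers of [w], and
    the exchange of these factors. *)
Definition V_linear : seq (V -> V) :=
  [seq (fun x : V =>
          let y := iter ij.1 mulw x.1.1 in let z := iter ij.2 mulw x.1.2 in
          if s then (z, y, x.2) else (y, z, x.2))
  | s <- [:: false; true], ij <- [seq (i, j) | i <- iota 0 3, j <- iota 0 3]].

Definition array32 : seq (seq nat) :=
  translates addV V_elts
    (fun x => nth 0 [:: 27; 29; 23; 24; 6; 17; 2; 1; 4; 0; 26; 25; 18; 11; 22; 5;
                        28; 13; 8; 21; 16; 15; 12; 20; 31; 10; 19; 7; 14; 30; 9; 3]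
                  (codeV x)) V_linear.

Lemma check_array7 : check 2 7 array7.
Proof. by vm_compute. Qed.

Lemma check_array8 : check 3 8 array8.
Proof. by vm_compute. Qed.

Lemma check_array12 : check 6 12 array12.
Proof. by vm_compute. Qed.

Lemma check_array14 : check 7 14 array14.
Proof. by vm_compute. Qed.

Lemma check_array16 : check 16 16 array16.
Proof. by vm_compute. Qed.

Lemma check_array19 : check 19 19 array19.
Proof. by vm_compute. Qed.

Lemma check_array32 : is_position_table 32 array32 && check_at 96 32 array32 0.
Proof. by vm_compute. Qed.

Lemma addVA : associative addV.
Proof. case=> [[[? ?] [? ?]] ?] [[[? ?] [? ?]] ?] [[[? ?] [? ?]] ?].
by rewrite /addV /addF4 /= !addbA. Qed.

Lemma addVC : commutative addV.
Proof. case=> [[[? ?] [? ?]] ?] [[[? ?] [? ?]] ?]; rewrite /addV /addF4 /=.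
by congr (_, _, (_, _), _); apply: addbC. Qed.

Lemma addVV x : addV x x = V0.
Proof. by case: x => [[[? ?] [? ?]] ?]; rewrite /addV /addF4 /= !addbb. Qed.

Lemma balanced_array32 i : i < 32 -> balanced_at 96 32 array32 i.
Proof.
apply: (@balanced_translates _ _ V0 V_elts addVA addVC _ addVV) => //.
- by case=> [[[? ?] [? ?]] ?].
- by case=> [[[[] []] [[] []]] []].
- by apply: check_atP; case/andP: check_array32.
Qed.

Theorem mainTheorem4 :
  (forall v : nat, 6 <= v <= 7 -> g v 3 = 2) /\
  g 8 3 = 3 /\
  g 9 3 <= 6 /\
  (forall v : nat, 10 <= v <= 12 -> g v 3 <= 6) /\
  (forall v : nat, 13 <= v <= 14 -> g v 3 <= 7) /\
  (forall v : nat, 15 <= v <= 16 -> g v 3 <= 16) /\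
  (forall v : nat, 17 <= v <= 19 -> g v 3 <= 19) /\
  (forall v : nat, 20 <= v <= 32 -> g v 3 <= 96) /\
  (forall v : nat, 6 <= v <= 9 -> g v 3 <= 8) /\
  (forall v : nat, 10 <= v <= 32 -> g v 3 <= 160).
Proof.
have le7 v : v <= 7 -> g v 3 <= 2 := g_le_check check_array7.
have le8 v : v <= 8 -> g v 3 <= 3 := g_le_check check_array8.
have le12 v : v <= 12 -> g v 3 <= 6 := g_le_check check_array12.
have le14 v : v <= 14 -> g v 3 <= 7 := g_le_check check_array14.
have le16 v : v <= 16 -> g v 3 <= 16 := g_le_check check_array16.
have le19 v : v <= 19 -> g v 3 <= 19 := g_le_check check_array19.
have le32 v : v <= 32 -> g v 3 <= 96.
  by case/andP: check_array32 => tab _; apply: (g_le _ tab balanced_array32).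
have ge2 v : 5 < v -> 1 < g v 3.
  move=> v5; have [g0 [X]] := g_PSCA v 3; rewrite ltn_neqAle g0 andbT.
  by case: eqP => // <- /(no_PSCA1 v5).
have ge3 : 2 < g 8 3.
  have [_ [X]] := g_PSCA 8 3; rewrite ltn_neqAle ge2 // andbT.
  by case: eqP => // <- /no_PSCA2.
split=> [v /andP[/ge2 lo /le7 hi]|]; first by apply/eqP; rewrite eqn_leq hi.
split; first by apply/eqP; rewrite eqn_leq le8.
split; first exact: le12.
split=> [v /andP[_ /le12]|] //; split=> [v /andP[_ /le14]|] //.
split=> [v /andP[_ /le16]|] //; split=> [v /andP[_ /le19]|] //.
split=> [v /andP[_ /le32]|] //; split=> v /andP[_ hi].
  by apply: leq_trans (le12 _ (leq_trans hi _)) _.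
exact: leq_trans (le32 v hi) _.
Qed.
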